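(* Let $f:{}^*\mathbb{R}\to{}^*\mathbb{R}$ be an internal mu-differentiable function with mu-derivative $f'$, and let $a\in\mathbb{R}$. If $a$ is a local m-minimizer of $f$, then $f'(a)\approx 0$.
   Context: Setting: nonstandard analysis; ${}^*\mathbb{R}$ is the field of hyperreals (a nonstandard extension of $\mathbb{R}$ satisfying the Transfer Principle), with the usual notion of internal sets and functions. ${}^*]b,c[$ denotes the nonstandard extension of the open interval $]b,c[$. For $x,y\in{}^*\mathbb{R}$: $x\approx 0$ ($x$ is infinitesimal) means $|x|<r$ for all real $r>0$; $x\approx y$ means $x-y\approx 0$; $x$ is finite if $|x|<r$ for some real $r>0$; $x$ is nearstandard, $x\in ns({}^*\mathbb{R})$, if $x\approx b$ for some (unique) $b\in\mathbb{R}$. We write $x\gtrsim y$ if $x\ge y$ or $x\approx y$. Mu-differentiability: an internal function $f:{}^*\mathbb{R}\to{}^*\mathbb{R}$ is mu-differentiable if $f(ns({}^*\mathbb{R}))\subseteq ns({}^*\mathbb{R})$ and there is an internal function $f':{}^*\mathbb{R}\to{}^*\mathbb{R}$ (a mu-derivative of $f$, in general not unique) such that (1) $f'(x)$ is finite whenever $x$ is nearstandard; (2) for each $b\in\mathbb{R}$ there is a positive infinitesimal $\delta_b$ such that for all $x,y\approx b$ with $|x-y|>\delta_b$ there is an infinitesimal $\eta$ with $f(x)-f(y)=f'(x)(x-y)+|x-y|\eta$. A point $a\in\mathbb{R}$ is a local m-minimizer of $f$ if there is a real $r>0$ such that $f(x)\gtrsim f(a)$ for all $x\in{}^*]a-r,a+r[$.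 *)

(* Defs.v *)
From mathcomp Require Import all_boot all_order all_algebra.
From mathcomp Require Import boolp classical_sets set_interval reals.
Set Implicit Arguments.
Unset Strict Implicit.
Unset Printing Implicit Defensive.
Import Order.TTheory GRing.Theory Num.Theory.
Local Open Scope ring_scope.

(* The universe over the reals is presented by simple types, as in Robinson's
   original treatment: reals, sets of objects of a given type, and functions
   between given types.  Relations and functions of several arguments are
   curried.  It plays the role of the superstructure V(R). *)
Inductive ty : Type :=
  | tyReal
  | tySet of ty
  | tyFun of ty & ty.

Fixpoint standard (R : realType) (t : ty) : Type :=
  match t with
  | tyReal => R
  | tySet s => set (standard R s)
  | tyFun s u => standard R s -> standard R u
  end.

(* Formulas, with typed de Bruijn variables and with every standard object
   available as a constant. *)
Inductive var : seq ty -> ty -> Type :=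
  | VarO (G : seq ty) (t : ty) : var (t :: G) t
  | VarS (G : seq ty) (s t : ty) : var G t -> var (s :: G) t.

Inductive term (R : realType) (G : seq ty) : ty -> Type :=
  | Var (t : ty) : var G t -> term R G t
  | Const (t : ty) : standard R t -> term R G t
  | App (s t : ty) : term R G (tyFun s t) -> term R G s -> term R G t.

Inductive formula (R : realType) : seq ty -> Type :=
  | Eq (G : seq ty) (t : ty) : term R G t -> term R G t -> formula R G
  | Mem (G : seq ty) (t : ty) :
      term R G t -> term R G (tySet t) -> formula R G
  | Not (G : seq ty) : formula R G -> formula R G
  | And (G : seq ty) : formula R G -> formula R G -> formula R G
  | All (G : seq ty) (t : ty) : formula R (t :: G) -> formula R G.

Record structure : Type := Structure {
  dom : ty -> Type;
  mem_dom : forall t : ty, dom t -> dom (tySet t) -> Prop;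
  app_dom : forall s t : ty, dom (tyFun s t) -> dom s -> dom t }.

Fixpoint env (M : structure) (G : seq ty) : Type :=
  match G with
  | [::] => unit
  | t :: G' => (dom M t * env M G')%type
  end.

Fixpoint lookup (M : structure) (G : seq ty) (t : ty) (v : var G t) :
    env M G -> dom M t :=
  match v in var G t return env M G -> dom M t with
  | VarO _ _ => fun e => e.1
  | VarS _ _ _ v' => fun e => lookup v' e.2
  end.

Fixpoint eval (R : realType) (M : structure)
    (c : forall t : ty, standard R t -> dom M t)
    (G : seq ty) (t : ty) (a : term R G t) (e : env M G) : dom M t :=
  match a in term _ _ t return dom M t with
  | Var _ v => lookup v e
  | Const _ k => c _ k
  | App _ _ f b => app_dom (eval c f e) (eval c b e)
  end.

Fixpoint holds (R : realType) (M : structure)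
    (c : forall t : ty, standard R t -> dom M t)
    (G : seq ty) (p : formula R G) : env M G -> Prop :=
  match p in formula _ G return env M G -> Prop with
  | Eq _ _ a b => fun e => eval c a e = eval c b e
  | Mem _ _ a b => fun e => mem_dom (eval c a e) (eval c b e)
  | Not _ q => fun e => ~ holds c q e
  | And _ q r => fun e => holds c q e /\ holds c r e
  | All _ t q => fun e => forall x : dom M t, holds c q (x, e)
  end.

Definition standard_structure (R : realType) : structure :=
  @Structure (standard R) (fun t x A => A x) (fun s t f x => f x).

(* Internal objects: hyperreals, internal sets, internal functions. *)
Definition internal_dom (H : Type) (iset : ty -> Type)
    (ifun : ty -> ty -> Type) (t : ty) : Type :=
  match t with
  | tyReal => H
  | tySet s => iset s
  | tyFun s u => ifun s u
  end.

(* [star] is the nonstandard extension map; quantifiers of the transferred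
   formula range over internal objects.  [starD], [starM], [star_le] say that
   the ordered field structure carried by [hyperreal] is the extension of the
   one of R; this determines it completely. *)
Record nonstandard_extension (R : realType) : Type := NonstandardExtension {
  hyperreal : realFieldType;
  internal_set : ty -> Type;
  internal_fun : ty -> ty -> Type;
  imem : forall t : ty,
    internal_dom hyperreal internal_set internal_fun t ->
    internal_set t -> Prop;
  iapp : forall s t : ty, internal_fun s t ->
    internal_dom hyperreal internal_set internal_fun s ->
    internal_dom hyperreal internal_set internal_fun t;
  star : forall t : ty, standard R t ->
    internal_dom hyperreal internal_set internal_fun t;
  transfer : forall p : formula R [::],
    @holds R (standard_structure R) (fun t x => x) [::] p tt <->
    @holds R (@Structure (internal_dom hyperreal internal_set internal_fun)
                imem iapp) star [::] p tt;
  starD : forall x y : hyperreal,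
    @iapp tyReal tyReal
      (@iapp tyReal (tyFun tyReal tyReal)
         (star (t := tyFun tyReal (tyFun tyReal tyReal)) (fun u v : R => u + v))
         x) y = x + y;
  starM : forall x y : hyperreal,
    @iapp tyReal tyReal
      (@iapp tyReal (tyFun tyReal tyReal)
         (star (t := tyFun tyReal (tyFun tyReal tyReal)) (fun u v : R => u * v))
         x) y = x * y;
  star_le : forall x y : hyperreal,
    @imem tyReal y
      (@iapp tyReal (tySet tyReal)
         (star (t := tyFun tyReal (tySet tyReal))
            (fun u : R => [set v : R | u <= v]%classic))
         x) <-> x <= y;
  star_proper : exists x : hyperreal, forall r : R, x <> star (t := tyReal) r }.

Definition hreal (R : realType) (X : nonstandard_extension R) (r : R) :
    hyperreal X :=
  @star R X tyReal r.

(* The nonstandard extension *A, as a set of hyperreals. *)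
Definition hset (R : realType) (X : nonstandard_extension R) (A : set R) :
    set (hyperreal X) :=
  [set x | @imem R X tyReal x (@star R X (tySet tyReal) A)]%classic.

Arguments hreal {R} X r.
Arguments hset {R} X A _.

Definition internal (R : realType) (X : nonstandard_extension R)
    (f : hyperreal X -> hyperreal X) : Prop :=
  exists g : internal_fun X tyReal tyReal,
    forall x : hyperreal X, f x = @iapp R X tyReal tyReal g x.

Definition infinitesimal (R : realType) (X : nonstandard_extension R)
    (x : hyperreal X) : Prop :=
  forall r : R, 0 < r -> `|x| < hreal X r.

Definition approx (R : realType) (X : nonstandard_extension R)
    (x y : hyperreal X) : Prop :=
  infinitesimal (x - y).

Definition hfinite (R : realType) (X : nonstandard_extension R)
    (x : hyperreal X) : Prop :=
  exists r : R, 0 < r /\ `|x| < hreal X r.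

Definition nearstandard (R : realType) (X : nonstandard_extension R)
    (x : hyperreal X) : Prop :=
  exists b : R, approx x (hreal X b).

Definition gtrsim (R : realType) (X : nonstandard_extension R)
    (x y : hyperreal X) : Prop :=
  y <= x \/ approx x y.

Definition mu_derivative (R : realType) (X : nonstandard_extension R)
    (f f' : hyperreal X -> hyperreal X) : Prop :=
  [/\ internal f',
      forall x : hyperreal X, nearstandard x -> hfinite (f' x)
    & forall b : R, exists delta : hyperreal X,
        [/\ 0 < delta, infinitesimal delta
          & forall x y : hyperreal X,
              approx x (hreal X b) -> approx y (hreal X b) ->
              delta < `|x - y| ->
              exists eta : hyperreal X, infinitesimal eta /\
                f x - f y = f' x * (x - y) + `|x - y| * eta]].

Definition mu_differentiable (R : realType) (X : nonstandard_extension R)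
    (f : hyperreal X -> hyperreal X) : Prop :=
  [/\ internal f,
      forall x : hyperreal X, nearstandard x -> nearstandard (f x)
    & exists f' : hyperreal X -> hyperreal X, mu_derivative f f'].

Definition local_m_minimizer (R : realType) (X : nonstandard_extension R)
    (f : hyperreal X -> hyperreal X) (a : R) : Prop :=
  exists r : R, 0 < r /\
    forall x : hyperreal X,
      hset X `]a - r, a + r[%classic x -> gtrsim (f x) (f (hreal X a)).

(* Main.v *)
Require Import Defs.
From mathcomp Require Import all_boot all_order all_algebra reals.
From mathcomp Require Import boolp classical_sets set_interval ring lra.
Set Implicit Arguments.
Unset Strict Implicit.
Unset Printing Implicit Defensive.
Import Order.TTheory GRing.Theory Num.Theory.
Local Open Scope ring_scope.

(* At infinitesimal distance, [f x >~ f a] carries no information, since [f]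
   maps the monad of [a] into the monad of [f a].  The argument therefore moves
   to a real distance.  If [f' a] is not infinitesimal, then for a suitable sign
   [s] and a real [m > 0] the inequality [f (a + s h) + m h <= f a] holds for
   all infinitesimal [h > delta].  The set of [h > delta] where it fails is
   internal and contains no infinitesimal, so by overspill it contains no small
   positive real [h] either, and such an [h] contradicts minimality. *)

(** * Derived connectives and the ordered-field vocabulary of formulas *)

Definition internal_structure (R : realType) (X : nonstandard_extension R) :
    structure :=
  @Structure
    (internal_dom (hyperreal X) (@internal_set R X) (@internal_fun R X))
    (@imem R X) (@iapp R X).

Definition Imp (R : realType) (G : seq ty) (p q : formula R G) : formula R G :=
  Not (And p (Not q)).

Definition Iff (R : realType) (G : seq ty) (p q : formula R G) : formula R G :=
  And (Imp p q) (Imp q p).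

Definition Ex (R : realType) (G : seq ty) (t : ty) (p : formula R (t :: G)) :
    formula R G :=
  Not (All (Not p)).

Section Connectives.
Variables (R : realType) (M : structure).
Variable c : forall t : ty, standard R t -> dom M t.

(* These two hold by conversion; used as views they keep [holds] folded, which
   the views for the derived connectives need. *)
Lemma holds_And (G : seq ty) (p q : formula R G) (e : env M G) :
  holds c (And p q) e <-> holds c p e /\ holds c q e.
Proof. by []. Qed.

Lemma holds_All (G : seq ty) (t : ty) (p : formula R (t :: G)) (e : env M G) :
  holds c (All p) e <-> forall x : dom M t, holds c p (x, e).
Proof. by []. Qed.

Lemma holds_Imp (G : seq ty) (p q : formula R G) (e : env M G) :
  holds c (Imp p q) e <-> (holds c p e -> holds c q e).
Proof.
split=> /= [pq hp | pq [hp hq]]; last exact/hq/pq.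
by apply: contrapT => hq; apply: pq.
Qed.

Lemma holds_Iff (G : seq ty) (p q : formula R G) (e : env M G) :
  holds c (Iff p q) e <-> (holds c p e <-> holds c q e).
Proof.
split=> [[/holds_Imp pq /holds_Imp qp]|[pq qp]]; first by [].
by split; apply/holds_Imp.
Qed.

Lemma holds_Ex (G : seq ty) (t : ty) (p : formula R (t :: G)) (e : env M G) :
  holds c (Ex p) e <-> exists x : dom M t, holds c p (x, e).
Proof.
split=> /= [np | [x px] np]; last exact: np px.
by apply: contrapT => nex; apply: np => x px; apply: nex; exists x.
Qed.

End Connectives.

Section RealTerms.
Variables (R : realType) (G : seq ty).
Implicit Types a b : term R G tyReal.

Definition Add a b : term R G tyReal :=
  App (App (Const G (t := tyFun tyReal (tyFun tyReal tyReal))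
              (fun u v : R => u + v)) a) b.

Definition Mul a b : term R G tyReal :=
  App (App (Const G (t := tyFun tyReal (tyFun tyReal tyReal))
              (fun u v : R => u * v)) a) b.

(** Atomic formulas are only equality and membership, so order becomes membership in the up-set of
    [a]; the constant is the one in [star_le]. *)
Definition Le a b : formula R G :=
  Defs.Mem b (App (Const G (t := tyFun tyReal (tySet tyReal))
                (fun u : R => [set v : R | u <= v]%classic)) a).

End RealTerms.

Local Notation v0 := (Var _ (VarO _ _)).
Local Notation v1 := (Var _ (VarS _ (VarO _ _))).
Local Notation v2 := (Var _ (VarS _ (VarS _ (VarO _ _)))).
Local Notation v3 := (Var _ (VarS _ (VarS _ (VarS _ (VarO _ _))))).
Local Notation v4 := (Var _ (VarS _ (VarS _ (VarS _ (VarS _ (VarO _ _)))))).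
Local Notation v5 :=
  (Var _ (VarS _ (VarS _ (VarS _ (VarS _ (VarS _ (VarO _ _))))))).
Local Notation v6 :=
  (Var _ (VarS _ (VarS _ (VarS _ (VarS _ (VarS _ (VarS _ (VarO _ _)))))))).

(** Since [inf A >= d > 0], twice [inf A] exceeds [inf A], so some member of [A] lies below the
    double. Unlike a minimum, such a member always exists. *)
Lemma near_minimum (R : realType) (d : R) (A : set R) :
  0 < d -> (forall x, A x -> d <= x) -> (exists x, A x) ->
  exists h, A h /\ forall x, A x -> h <= x + x.
Proof.
move=> d0 dA Ane.
have infA : has_inf A by split=> //; exists d.
have d_inf : d <= inf A by apply: lb_le_inf => //; case: infA.
have [h Ah hlt] := inf_adherent (lt_le_trans d0 d_inf) infA.
exists h; split=> // x Ax.
have := ge_inf infA.2 Ax; lra.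
Qed.

(** * Transfer and the embedding of the reals as an ordered field *)

Section Extension.
Variables (R : realType) (X : nonstandard_extension R).
Local Notation hr := (hreal X).
Local Notation H := (hyperreal X).
Local Notation sat := (@holds R (internal_structure X) (@star R X)).

Lemma transferI (p : formula R [::]) :
  @holds R (standard_structure R) (fun t x => x) [::] p tt -> sat p tt.
Proof. by move=> hp; apply/(@transfer R X). Qed.

Lemma hreal_in_hset (A : set R) (x : R) : A x -> hset X A (hr x).
Proof.
move=> Ax; apply: (transferI (p := Defs.Mem
  (Const [::] (t := tyReal) x) (Const [::] (t := tySet tyReal) A))).
exact: Ax.
Qed.

Lemma hrealD (x y : R) : hr (x + y) = hr x + hr y.
Proof.
have /= := @transferI
  (Eq (Add (Const [::] (t := tyReal) x) (Const [::] (t := tyReal) y))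
           (Const [::] (t := tyReal) (x + y))) erefl.
by rewrite starD.
Qed.

Lemma hrealM (x y : R) : hr (x * y) = hr x * hr y.
Proof.
have /= := @transferI
  (Eq (Mul (Const [::] (t := tyReal) x) (Const [::] (t := tyReal) y))
           (Const [::] (t := tyReal) (x * y))) erefl.
by rewrite starM.
Qed.

Lemma hreal_le (x y : R) : x <= y -> hr x <= hr y.
Proof.
move=> xy; apply/(@star_le R X); apply: (transferI
  (p := Le (Const [::] (t := tyReal) x) (Const [::] (t := tyReal) y))).
exact: xy.
Qed.

(** Transfer is used from right to left here; strictness of the embedded order rests on this. *)
Lemma hreal_inj : injective (hreal X).
Proof.
move=> x y; apply: (iffRL (@transfer R X
  (Eq (Const [::] (t := tyReal) x) (Const [::] (t := tyReal) y)))).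
Qed.

Lemma hreal_lt (x y : R) : x < y -> hr x < hr y.
Proof.
rewrite !lt_neqAle => /andP[xy /hreal_le ->]; rewrite andbT.
by apply: contra_neq xy; exact: hreal_inj.
Qed.

(** Of the field operations only sums and products are prescribed; 0, negatives and 1 follow by
    cancellation. *)
Lemma hreal0 : hr 0 = 0.
Proof. by apply: (addIr (hr 0)); rewrite -hrealD !add0r. Qed.

Lemma hrealN (x : R) : hr (- x) = - hr x.
Proof. by apply: (addIr (hr x)); rewrite -hrealD !addNr hreal0. Qed.

Lemma hreal1 : hr 1 = 1.
Proof.
have h0 : hr 1 != 0.
  by rewrite -hreal0; apply: contra_neq (oner_neq0 R); exact: hreal_inj.
by apply: (mulIf h0); rewrite -hrealM !mul1r.
Qed.

Lemma hreal_gt0 (x : R) : 0 < x -> 0 < hr x.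
Proof. by move=> /hreal_lt; rewrite hreal0. Qed.

Lemma hreal_norm (x : R) : hr `|x| = `|hr x|.
Proof.
have [x0|/hreal_lt] := ger0P x.
  by rewrite ger0_norm// -hreal0 hreal_le.
by rewrite hreal0 hrealN => x0; rewrite ltr0_norm.
Qed.

(** * Overspill for internal sets of positive hyperreals *)

Lemma not_infinitesimal (x : H) :
  ~ infinitesimal x -> exists r : R, 0 < r /\ hr r <= `|x|.
Proof.
move=> nx; apply: contrapT => nr; apply: nx => r r0.
by rewrite ltNge; apply/negP => rx; apply: nr; exists r.
Qed.

(* Within a factor 2 of its infimum a nonempty [A] has an element, and that
   element is not infinitesimal. *)
Lemma internal_set_away_from0 (A : internal_set X tyReal) (d : H) :
  0 < d -> (forall x : H, @imem R X tyReal x A -> d <= x) ->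
  (forall x : H, infinitesimal x -> ~ @imem R X tyReal x A) ->
  exists r : R, 0 < r /\
    forall x : H, x <= hr r -> ~ @imem R X tyReal x A.
Proof.
move=> d0 dA infA.
have [Ane|A0] := pselect (exists x : H, @imem R X tyReal x A); last first.
  by exists 1; split=> // x _ Ax; apply: A0; exists x.
(* [~ (d + d <= d)] expresses [0 < d] without a constant for 0. *)
pose bounded : formula R [:: tySet tyReal; tyReal] :=
  And (Not (Le (Add v1 v1) v1))
    (And (All (Imp (Defs.Mem v0 v1) (Le v2 v0)))
         (Ex (t := tyReal) (Defs.Mem v0 v1))).
(* The sentence [p] is [near_minimum] quantified over all bounds and sets, so that it transfers to
   internal sets. *)
pose p : formula R [::] := All (t := tyReal) (All (Imp bounded
  (Ex (t := tyReal) (And (Defs.Mem v0 v1) (All (t := tyReal)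
     (Imp (Defs.Mem v0 v2) (Le v1 (Add v0 v0)))))))).
have std : @holds R (standard_structure R) (fun t x => x) [::] p tt.
  apply/holds_All => e; apply/holds_All => B; apply/holds_Imp.
  move=> /holds_And[e0 /holds_And[/holds_All eB /holds_Ex Bne]].
  have [||//|h [Bh hB]] := @near_minimum _ e B.
  - by move/negP: e0; rewrite /= -ltNge; lra.
  - by move=> x; have /holds_Imp := eB x.
  apply/holds_Ex; exists h; apply/holds_And; split=> //.
  by apply/holds_All => x; apply/holds_Imp; exact: hB.
have dA_bounded : sat bounded (A, (d, tt)).
  apply/holds_And; split; first by rewrite /= starD => /star_le; lra.
  apply/holds_And; split; last by apply/holds_Ex.
  by apply/holds_All => x; apply/holds_Imp => /= /dA dx; apply/star_le.
have /holds_All/(_ d)/holds_All/(_ A) := transferI std.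
move=> /holds_Imp/(_ dA_bounded)/holds_Ex[h /holds_And[Ah /holds_All hA]].
have h0 : 0 < h := lt_le_trans d0 (dA _ Ah).
have [r [r0]] : exists r : R, 0 < r /\ hr r <= `|h|.
  by apply: not_infinitesimal => /infA.
rewrite (gtr0_norm h0) => rh.
(* A member [x <= hr (r / 4)] would give [h <= x + x <= hr (r / 2) < hr r <= h]. *)
exists (r / 4); split=> [|x xr Ax]; first lra.
have /holds_Imp/(_ Ax) /= := hA x.
rewrite starD => /star_le hx.
have : hr r = hr (r / 4) + hr (r / 4) + (hr (r / 4) + hr (r / 4)).
  by rewrite -!hrealD; congr hr; lra.
have := hreal_gt0 r0; lra.
Qed.

(** An instance of the internal definition principle: the parameters may be nonstandard, so they are
    quantified variables of the transferred sentence, not constants. *)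
Lemma failure_set (g : internal_fun X tyReal tyReal) (a s m d : H) :
  exists A : internal_set X tyReal, forall h : H,
    @imem R X tyReal h A <->
      d < h /\ @iapp R X tyReal tyReal g a <
               @iapp R X tyReal tyReal g (a + s * h) + m * h.
Proof.
(* Innermost, [v0] to [v6] stand for [h], [A], [d], [m], [s], [a], [g]; strict inequalities are
   negated [Le]. *)
pose p : formula R [::] :=
  All (t := tyFun tyReal tyReal) (All (t := tyReal) (All (t := tyReal)
    (All (t := tyReal) (All (t := tyReal) (Ex (t := tySet tyReal)
      (All (t := tyReal) (Iff (Defs.Mem v0 v1)
        (And (Not (Le v0 v2))
          (Not (Le (Add (App v6 (Add v5 (Mul v4 v0))) (Mul v3 v0))
                   (App v6 v5))))))))))).
have std : @holds R (standard_structure R) (fun t x => x) [::] p tt.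
  apply/holds_All => g'; apply/holds_All => a'; apply/holds_All => s'.
  apply/holds_All => m'; apply/holds_All => d'; apply/holds_Ex.
  exists [set h : R | ~ (h <= d') /\
           ~ (g' (a' + s' * h) + m' * h <= g' a')]%classic.
  by apply/holds_All => h; apply/holds_Iff.
have /holds_All/(_ g)/holds_All/(_ a)/holds_All/(_ s) := transferI std.
move=> /holds_All/(_ m)/holds_All/(_ d)/holds_Ex[A /holds_All hA].
exists A => h; have /holds_Iff /= := hA h.
rewrite !(starM, starD) => ->.
by split=> -[h1 h2]; split; [rewrite ltNge|rewrite ltNge| |];
   [apply/negP => /star_le|apply/negP => /star_le|
    move=> /star_le; rewrite leNgt h1|move=> /star_le; rewrite leNgt h2].
Qed.

(** * From infinitesimal distances to real ones *)

Lemma real_decrease (f : H -> H) (a s m d : H) :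
  internal f -> 0 < d -> infinitesimal d ->
  (forall h : H, d < h -> infinitesimal h -> f (a + s * h) + m * h <= f a) ->
  exists r : R, 0 < r /\ forall t : R, 0 < t -> t <= r ->
    f (a + s * hr t) + m * hr t <= f a.
Proof.
move=> [g fg] d0 dinf dec.
have [A hA] := failure_set g a s m d.
have [||r [r0 rA]] := internal_set_away_from0 (A := A) d0.
- by move=> x /hA[/ltW].
- by move=> x ix /hA[dx]; rewrite -!fg ltNge dec.
exists r; split=> // t t0 tr; rewrite leNgt; apply/negP => lt_f.
apply: (rA (hr t)); first exact: hreal_le.
apply/hA; rewrite -!fg; split=> //.
(* The infinitesimal [d] lies below every positive real, so [d < h] holds at [h = hr t]. *)
by have := dinf t t0; rewrite gtr0_norm.
Qed.

(** A slope of at most [- hr r] in direction [s] would persist, halved, up to a real distance, where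
    [f] drops by a noninfinitesimal amount. *)
Lemma no_descent_direction (f f' : H -> H) (a s : R) :
  internal f -> mu_derivative f f' -> local_m_minimizer f a -> `|s| = 1 ->
  forall r : R, 0 < r -> - hr r < hr s * f' (hr a).
Proof.
move=> fint [_ _ /(_ a)[d [d0 dinf fd]]] [q [q0 amin]] s1 r r0.
rewrite ltNge; apply/negP => sr.
(* Half of the slope [r] is given up to absorb the error [eta]. *)
have r2 : 0 < r / 2 by lra.
have hrr : hr r = hr (r / 2) + hr (r / 2) by rewrite -hrealD -splitr.
have absh (h : H) : 0 < h -> `|hr s * h| = h.
  by move=> h0; rewrite normrM -hreal_norm s1 hreal1 mul1r gtr0_norm.
have [|e [e0 dec]] :=
  @real_decrease f (hr a) (hr s) (hr (r / 2)) d fint d0 dinf.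
  move=> h dh ih.
  have h0 : 0 < h := lt_trans d0 dh.
  have dist : `|hr a - (hr a + hr s * h)| = h.
    by rewrite opprD addNKr normrN absh.
  (* The derivative is evaluated at the first argument of [fd], so [hr a] comes first. *)
  have [|||eta [ieta]] := fd (hr a) (hr a + hr s * h).
  - by move=> t t0; rewrite subrr normr0 hreal_gt0.
  - by move=> t t0; rewrite addrAC subrr add0r absh// -[h]gtr0_norm// ih.
  - by rewrite dist.
  rewrite dist => eqf.
  have := ieta _ r2; rewrite ltr_norml => /andP[eta1 eta2].
  have k : 0 <= h * (- hr (r / 2) - hr s * f' (hr a) + eta) by nra.
  have : f (hr a) - f (hr a + hr s * h) = - (h * (hr s * f' (hr a))) + h * eta.
    by rewrite eqf; ring.
  move: k; rewrite !mulrDr !mulrN; lra.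
pose t := Num.min e (q / 2).
have t0 : 0 < t by rewrite lt_min e0 /=; lra.
have te : t <= e by rewrite ge_min lexx.
have tq : t <= q / 2 by rewrite ge_min lexx orbT.
have := dec t t0 te; rewrite -!hrealM -hrealD => lt_f.
(* The drop at [t] is at least the positive real [r / 2 * t], which refutes both alternatives of
   [gtrsim]. *)
have rt : 0 < r / 2 * t by rewrite mulr_gt0.
have hrt := hreal_gt0 rt.
have /amin [|/(_ _ rt)] : hset X `]a - q, a + q[%classic (hr (a + s * t)).
  apply: hreal_in_hset; rewrite /= in_itv/=.
  rewrite -ltr_distlC opprD addNKr normrN normrM s1 mul1r gtr0_norm//; lra.
- lra.
by rewrite ltr_norml => /andP[+ _]; lra.
Qed.

End Extension.

Theorem mainTheorem2 (R : realType) (X : nonstandard_extension R)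
    (f f' : hyperreal X -> hyperreal X) (a : R)
    (f_internal : internal f)
    (f_mu_diff : mu_differentiable f)
    (f'_mu_derivative : mu_derivative f f')
    (a_min : local_m_minimizer f a) :
  approx (f' (hreal X a)) 0%R.
Proof.
move=> r r0; rewrite subr0 ltr_norml.
(* Direction [1] gives the lower bound, direction [-1] the upper one. *)
have := no_descent_direction f_internal f'_mu_derivative a_min (normr1 R) r0.
rewrite hreal1 mul1r => ->/=.
have := no_descent_direction f_internal f'_mu_derivative a_min (normrN1 R) r0.
by rewrite hrealN hreal1 mulN1r ltrN2.
Qed.
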